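(* Let $n$ be an odd positive integer and let $f(x)=x^n+\sum_{i\in S} x^i+1\in\mathbb{F}_2[x]$, where $S$ is a set of integers satisfying $$S\subset \{\,i : i \text{ odd},\ 0<i<n/3\,\}\cup\{\,i : i\equiv n \pmod 4,\ 0<i<n\,\}.$$ Then $f$ has no repeated roots (in an algebraic closure of $\mathbb{F}_2$). If $n\equiv\pm1\pmod 8$, then $f$ has an odd number of irreducible factors over $\mathbb{F}_2$. If $n\equiv\pm3\pmod 8$, then $f$ has an even number of irreducible factors over $\mathbb{F}_2$.
   Context: $\mathbb{F}_2$ is the field with two elements. The set $S$ may be empty. *)

(* Defs.v *)
From mathcomp Require Import all_boot all_order all_algebra.
From mathcomp Require Import closed_field.

Set Implicit Arguments.
Unset Strict Implicit.
Unset Printing Implicit Defensive.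

Import GRing.Theory.
Local Open Scope ring_scope.

(* Since iota is injective and L is closed, integrality of L over F makes L an
   algebraic closure of F. For F = 'F_2 such an L exists, by
   countable_algebraic_closure (closed_field.v), so quantifying over all of them
   is not vacuous. *)
Definition no_repeated_roots (F : fieldType) (p : {poly F}) : Prop :=
  forall (L : closedFieldType) (iota : {rmorphism F -> L}),
    integralRange iota ->
    forall x : L, ~~ (('X - x%:P) ^+ 2 %| map_poly iota p).

(* Distinct irreducible factors up to units: each class of associates is
   counted through its monic member. For p != 0 every divisor q of p satisfies
   size q <= size p, so the bounded type {poly_(size p) F} misses none. When p
   has no repeated factor this is also the count with multiplicity. *)
Definition nb_irreducible_factors (F : finFieldType) (p : {poly F}) : nat :=
  #|[set q : {poly_(size p) F} |
      [&& (q : {poly F}) \is monic, irreducibleb q & (q : {poly F}) %| p]]|.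

(* Main.v *)
Require Import Defs.
From mathcomp Require Import all_boot all_order all_algebra.
From mathcomp Require Import all_fingroup closed_field algC algnum.
From mathcomp Require Import mpoly ring zify.

Set Implicit Arguments.
Unset Strict Implicit.
Unset Printing Implicit Defensive.

Import GRing.Theory.
Local Open Scope ring_scope.

(* Since every exponent of f is odd, x f' = f + 1 over F_2, so f is separable.

   The parity of the number of factors is Stickelberger's theorem, as follows.
   For roots x_i put V = prod_{i<j} (x_j - x_i) and A = prod_{i<j} (x_j + x_i).
   The polynomial G = (A - V)/2 has integer coefficients, and a permutation s
   of the x_i sends it to G or to A - G according to the sign of s, so
   Q = G (A - G) = (A^2 - V^2)/4 is symmetric. In characteristic 2, let s be the
   permutation that Frobenius induces on the roots of f: then A = 1 and
   G^2 = G or 1 - G, so Q = G - G^2 is the parity of s, that is, of n minus the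
   number of factors. Being symmetric, Q has the same value mod 2 on the roots
   r_i in C of the integer lift F, where V^2 = A^2 - 4 Q = 1 - 4 Q mod 8.

   Finally (-1)^C(n,2) V^2 = prod_i F'(r_i) = prod_i (n + 2 y_i), where
   y_i = sum_{j in S} ((n - j)/2) r_i^j. Newton's identities give
   sum_i r_i^m = 0 for odd m < n and 4 | sum_i r_i^m for even m with
   0 < m < 2n/3, hence sum_i y_i = 0 and 4 | sum_i y_i^2, and the product is
   n^n = n mod 8. *)

(** * The symmetric function of Swan's theorem *)

Lemma rmorph_mmap_int (R S : comNzRingType) (phi : {rmorphism R -> S}) n
    (r : 'I_n -> R) (p : {mpoly int[n]}) :
  phi (mmap intr r p) = mmap intr (phi \o r) p.
Proof.
rewrite /mmap rmorph_sum; apply: eq_bigr => m _.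
rewrite rmorphM rmorph_int /mmap1 rmorph_prod; congr (_ * _).
by apply: eq_bigr => i _; rewrite rmorphXn.
Qed.

Lemma mmap_intX (R : comNzRingType) n (r : 'I_n -> R) i :
  mmap intr r ('X_i : {mpoly int[n]}) = r i.
Proof. by rewrite mmapX mmap1U. Qed.

Lemma mmap_int_msym (R : comNzRingType) n (r : 'I_n -> R) (s : 'S_n)
    (p : {mpoly int[n]}) :
  mmap intr r (msym s p) = mmap intr (r \o s) p.
Proof.
rewrite {1}/msym {2}/mmap rmorph_sum; apply: eq_bigr => m _.
rewrite rmorphM /= mmapC /mmap1 rmorph_prod; congr (_ * _).
by apply: eq_bigr => i _; rewrite rmorphXn /= mmap_intX.
Qed.

Lemma mmap_int_comp (R : comNzRingType) n k (r : 'I_k -> R)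
    (t : {mpoly int[n]}) (u : n.-tuple {mpoly int[k]}) :
  mmap intr r (t \mPo u) = mmap intr (fun i => mmap intr r (tnth u i)) t.
Proof.
rewrite /comp_mpoly {2}/mmap rmorph_sum; apply: eq_bigr => m _.
rewrite rmorphM /= mmapC /mmap1 rmorph_prod; congr (_ * _).
by apply: eq_bigr => i _; rewrite rmorphXn.
Qed.

Lemma mmap_int_mesym (R : comNzRingType) n (r : 'I_n -> R) k :
  mmap intr r (mesym n int k) = (mesym n R k).@[r].
Proof.
rewrite /mesym !rmorph_sum; apply: eq_bigr => h _.
by rewrite !rmorph_prod; apply: eq_bigr => i _; rewrite /= mmap_intX mevalXU.
Qed.

Lemma eq_mmap_int (R : comNzRingType) n (r1 r2 : 'I_n -> R)
    (p : {mpoly int[n]}) :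
  r1 =1 r2 -> mmap intr r1 p = mmap intr r2 p.
Proof.
by move=> eq_r; apply: eq_bigr => m _; rewrite (mmap1_eq _ eq_r).
Qed.

(** A symmetric polynomial is a polynomial in the elementary symmetric ones, whose values at the
    roots of F are signed coefficients of F. Hence one integer [z] serves in characteristic 0 and in
    characteristic 2. *)
Lemma symmetric_mmap_int n (F : {poly int}) (p : {mpoly int[n]}) :
  p \is symmetric ->
  exists z : int, forall (R : idomainType) (r : 'I_n -> R),
    map_poly intr F = \prod_i ('X - (r i)%:P) -> mmap intr r p = z%:~R.
Proof.
case/sym_fundamental => t [<- _].
(* By Vieta, [c i] gives the elementary symmetric function of degree i + 1, as indices start at
   0. *)
pose c (i : 'I_n) : int := (-1) ^+ i.+1 * F`_(n - i.+1).
exists (mmap intr c t) => R r FE.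
rewrite mmap_int_comp rmorph_mmap_int; apply: eq_mmap_int => i /=.
rewrite tnth_mktuple mmap_int_mesym /c rmorphM rmorphXn rmorphN1 -coef_map FE.
have := mroots_coeff [tuple r i | i < n] (lift ord0 i).
rewrite big_tuple (eq_bigr (fun i => 'X - (r i)%:P)) => [->|j _].
  rewrite mulrA -exprD addnn -signr_odd odd_double mul1r.
  by apply: meval_eq => j; rewrite tnth_mktuple.
by rewrite tnth_mktuple.
Qed.

Definition pairwise_diff (R : comNzRingType) n (r : 'I_n -> R) : R :=
  \prod_(i < n) \prod_(j < n | (i < j)%N) (r j - r i).

Definition pairwise_sum (R : comNzRingType) n (r : 'I_n -> R) : R :=
  \prod_(i < n) \prod_(j < n | (i < j)%N) (r j + r i).

Lemma rmorph_pairwise_diff (R S : comNzRingType) (phi : {rmorphism R -> S}) n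
    (r : 'I_n -> R) : phi (pairwise_diff r) = pairwise_diff (phi \o r).
Proof.
rewrite rmorph_prod; apply: eq_bigr => i _.
by rewrite rmorph_prod; apply: eq_bigr => j _; rewrite rmorphB.
Qed.

Lemma rmorph_pairwise_sum (R S : comNzRingType) (phi : {rmorphism R -> S}) n
    (r : 'I_n -> R) : phi (pairwise_sum r) = pairwise_sum (phi \o r).
Proof.
rewrite rmorph_prod; apply: eq_bigr => i _.
by rewrite rmorph_prod; apply: eq_bigr => j _; rewrite rmorphD.
Qed.

Lemma eq_pairwise_diff (R : comNzRingType) n (r1 r2 : 'I_n -> R) :
  r1 =1 r2 -> pairwise_diff r1 = pairwise_diff r2.
Proof.
by move=> eq_r; apply: eq_bigr => i _; apply: eq_bigr => j _; rewrite !eq_r.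
Qed.

Lemma eq_pairwise_sum (R : comNzRingType) n (r1 r2 : 'I_n -> R) :
  r1 =1 r2 -> pairwise_sum r1 = pairwise_sum r2.
Proof.
by move=> eq_r; apply: eq_bigr => i _; apply: eq_bigr => j _; rewrite !eq_r.
Qed.

Lemma pairwise_diff_neq0 (R : idomainType) n (r : 'I_n -> R) :
  injective r -> pairwise_diff r != 0.
Proof.
move=> injr; apply/prodf_neq0 => i _; apply/prodf_neq0 => j lt_ij.
by rewrite subr_eq0 (inj_eq injr) -val_eqE gtn_eqF.
Qed.

(** This is a Vandermonde determinant, whose columns [s] permutes. *)
Lemma pairwise_diff_perm (R : comNzRingType) n (r : 'I_n -> R) (s : 'S_n) :
  pairwise_diff (r \o s) = (-1) ^+ s * pairwise_diff r.
Proof.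
have detE (u : 'I_n -> R) : pairwise_diff u = \det (Vandermonde n (\row_i u i)).
  rewrite det_Vandermonde; apply: eq_bigr => i _.
  by apply: eq_bigr => j _; rewrite !mxE.
have ->: pairwise_diff (r \o s)
    = \det (col_perm s (Vandermonde n (\row_i r i))).
  by rewrite detE; congr (\det _); apply/matrixP => i j; rewrite !mxE.
by rewrite col_permE det_mulmx det_perm odd_permV mulrC -detE.
Qed.

Lemma pairwise_diff_sqr (R : comNzRingType) n (r : 'I_n -> R) :
  pairwise_diff (fun i => r i ^+ 2) = pairwise_diff r * pairwise_sum r.
Proof.
rewrite -big_split; apply: eq_bigr => i _.
by rewrite -big_split; apply: eq_bigr => j _; rewrite subr_sqr.
Qed.

(* [pairwise_diff_sqr] expresses the sum product as a quotient of two
   Vandermonde determinants, whose signs cancel. *)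
Lemma pairwise_sum_perm (R : idomainType) n (r : 'I_n -> R) (s : 'S_n) :
  injective r -> pairwise_sum (r \o s) = pairwise_sum r.
Proof.
move=> injr; have injrs: injective (r \o s) by apply: inj_comp => //; apply: perm_inj.
apply: (mulfI (pairwise_diff_neq0 injrs)).
rewrite -pairwise_diff_sqr pairwise_diff_perm -mulrA -pairwise_diff_sqr.
by rewrite -pairwise_diff_perm.
Qed.

(** Congruences modulo 2 multiply, and each single factor satisfies one. Applied to the variables
    X_i, this produces G. *)
Lemma pairwise_sum_diff_mod2 (R : comNzRingType) n (r : 'I_n -> R) :
  exists g, pairwise_sum r = pairwise_diff r + g *+ 2.
Proof.
pose cong x y := exists g : R, x = y + g *+ 2.
have cong1 : cong 1 1 by exists 0; rewrite mul0rn addr0.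
have congM x1 x2 y1 y2 : cong x1 x2 -> cong y1 y2 -> cong (x1 * y1) (x2 * y2).
  by move=> [g ->] [h ->]; exists (x2 * h + g * y2 + (g * h) *+ 2); ring.
apply: (big_ind2 cong) => // i _; apply: (big_ind2 cong) => // j _.
by exists (r i); rewrite mulr2n addrA subrK.
Qed.

(** [a] and [q] are the values of A and Q = G (A - G). Both polynomials are symmetric, so the same
    integers serve for the complex roots of F and for its roots in characteristic 2, where [s] is
    the action of Frobenius. *)
Lemma swan_invariants n (F : {poly int}) :
  exists a q : int,
  [/\ forall (R : idomainType) (r : 'I_n -> R),
     map_poly intr F = \prod_i ('X - (r i)%:P) ->
     pairwise_sum r = a%:~R /\ pairwise_diff r ^+ 2 = (a ^+ 2 - q *+ 4)%:~R
   & forall (R : idomainType) (r : 'I_n -> R) (s : 'S_n),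
     map_poly intr F = \prod_i ('X - (r i)%:P) ->
     2 \in [pchar R] -> injective r -> (forall i, r (s i) = r i ^+ 2) ->
     pairwise_sum r = 1 /\ q%:~R = s%:R :> R].
Proof.
pose X (i : 'I_n) : {mpoly int[n]} := 'X_i.
have injX : injective X.
  move=> i j /(congr1 (mcoeff U_(i))); rewrite !mcoeffXU eqxx.
  by case: eqP => // _ /eqP; rewrite oner_eq0.
have [G AE] := pairwise_sum_diff_mod2 X.
set A := pairwise_sum X in AE; set V := pairwise_diff X in AE.
have msymE_X (s : 'S_n) : msym s \o X =1 X \o s.
  by move=> i; rewrite /= /msym mmapX mmap1U.
have msymA (s : 'S_n) : msym s A = A.
  rewrite rmorph_pairwise_sum (eq_pairwise_sum (msymE_X s)).
  exact: pairwise_sum_perm.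
have msymV (s : 'S_n) : msym s V = (-1) ^+ s * V.
  by rewrite rmorph_pairwise_diff (eq_pairwise_diff (msymE_X s)) pairwise_diff_perm.
(* Applying [s] to A = V + 2 G gives A = V + 2 s(G) or A = -V + 2 s(G), and 2 can be cancelled in
   integer polynomials. *)
have msymG (s : 'S_n) : msym s G = if s then A - G else G.
  have two_inj : injective (fun p : {mpoly int[n]} => p *+ 2).
    move=> p p' /= eq_p; apply/mpolyP => m; apply/(@Num.Theory.pmulrnI _ 2) => //.
    by rewrite -!mcoeffMn eq_p.
  apply: two_inj; have := congr1 (msym s) AE.
  rewrite rmorphD rmorphMn /= msymA msymV.
  case: (s : bool) => [/= /(canLR (addKr _)) <-|/= ]; rewrite AE; first by ring.
  by rewrite expr0 mul1r => /addrI.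
pose Q := G * (A - G).
have Q_sym : Q \is symmetric.
  apply/issymP => s; rewrite rmorphM rmorphB /= msymA msymG.
  by case: (s : bool) => //; rewrite /Q; ring.
have A_sym : A \is symmetric by apply/issymP.
have [a aE] := symmetric_mmap_int F A_sym.
have [q qE] := symmetric_mmap_int F Q_sym.
have XrE (R : idomainType) (r : 'I_n -> R) : mmap intr r \o X =1 r.
  by move=> i; exact: mmap_intX.
have ArE (R : idomainType) (r : 'I_n -> R) : mmap intr r A = pairwise_sum r.
  by rewrite rmorph_pairwise_sum (eq_pairwise_sum (XrE R r)).
have VrE (R : idomainType) (r : 'I_n -> R) : mmap intr r V = pairwise_diff r.
  by rewrite rmorph_pairwise_diff (eq_pairwise_diff (XrE R r)).
exists a, q; split=> [R r FE|R r s FE char2 injr frob].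
  rewrite -ArE; split; first exact: aE.
  rewrite -VrE rmorphB rmorphMn rmorphXn /= -(aE _ _ FE) -(qE _ _ FE) -!rmorphXn.
  by rewrite -rmorphMn -rmorphB /= /Q AE; congr (mmap _ _ _); ring.
(* Squaring is a ring morphism that fixes the image of the integers, so it acts on a value of [p]
   only through the roots, which it permutes by [s]. *)
have frobE (p : {mpoly int[n]}) : mmap intr r p ^+ 2 = mmap intr r (msym s p).
  rewrite -(pFrobenius_autE char2) rmorph_mmap_int mmap_int_msym.
  by apply: eq_mmap_int => i; rewrite /= frob.
have A1 : mmap intr r A = 1.
  (* V A is the difference product of the squares of the roots, which are again distinct. Then A^2 =
     A forces A = 1. *)
  have A_neq0 : mmap intr r A != 0.
    rewrite ArE; apply: contra_neq (pairwise_diff_neq0 injr) => A0.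
    have := pairwise_diff_neq0 (inj_comp injr (@perm_inj _ s)).
    by rewrite (eq_pairwise_diff frob) pairwise_diff_sqr A0 mulr0 eqxx.
  by apply: (mulfI A_neq0); rewrite mulr1 -expr2 frobE msymA.
split; first by rewrite -ArE.
(* Now Q = G - G^2 with G^2 = s(G): this is 0 for even [s], and 2 G - 1 = 1 for odd [s]. *)
rewrite -(qE _ _ FE) rmorphM rmorphB /= A1 mulrBr mulr1 -expr2 frobE msymG.
case: (s : bool); rewrite ?subrr // rmorphB /= A1 opprB addrA.
by rewrite (addrr_pchar2 char2) add0r (oppr_pchar2 char2).
Qed.

(** * Frobenius orbits and irreducible factors *)

Lemma F2_cases (x : 'F_2) : x = 0 \/ x = 1.
Proof.
case: x => [[|[|k]] lt_k2] //; [left | right]; exact: val_inj.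
Qed.

Section FrobeniusOrbits.

Variables (L : fieldType) (iota : {rmorphism 'F_2 -> L}) (n : nat).
Variables (r : 'I_n -> L) (s : {perm 'I_n}).
Hypotheses (injr : injective r) (frob : forall i, r (s i) = r i ^+ 2).

Local Notation "p ^iota" := (map_poly iota p) (at level 2, format "p ^iota").

Lemma pchar_F2_ext : 2 \in [pchar L].
Proof. by rewrite (fmorph_pchar iota) inE /=. Qed.

Let Frob : L -> L := pFrobenius_aut pchar_F2_ext.

Let Frob_iota x : Frob (iota x) = iota x.
Proof.
by rewrite /Frob; case: (F2_cases x) => ->; rewrite ?(rmorph0, rmorph1).
Qed.

Let Frob_r i : Frob (r i) = r (s i).
Proof. by rewrite frob. Qed.

(** Frobenius fixes the coefficients of [q], hence permutes its roots. *)
Lemma root_porbit (q : {poly 'F_2}) i j :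
  j \in porbit s i -> root q^iota (r i) -> root q^iota (r j).
Proof.
case/porbitP => k -> {j}; elim: k => [|k IHk]; first by rewrite expg0 perm1.
move/IHk => /(rmorph_root (pFrobenius_aut pchar_F2_ext)).
rewrite -map_poly_comp (eq_map_poly Frob_iota) expgSr permM.
by rewrite -Frob_r.
Qed.

Definition orbit_poly (O : {set 'I_n}) : {poly L} := \prod_(i in O) ('X - (r i)%:P).

(** For an orbit the coefficients of [orbit_poly] are 0 or 1, so testing them against 0 descends the
    polynomial to F_2 without an inverse of [iota]. *)
Definition orbit_factor (O : {set 'I_n}) : {poly 'F_2} :=
  \poly_(k < size (orbit_poly O)) ((orbit_poly O)`_k != 0)%:R.

Lemma root_orbit_poly O i : root (orbit_poly O) (r i) = (i \in O).
Proof.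
rewrite /orbit_poly -big_enum -(big_map r predT (fun x => 'X - x%:P)).
by rewrite root_prod_XsubC mem_map // mem_enum.
Qed.

Lemma monic_orbit_poly O : orbit_poly O \is monic.
Proof. exact: monic_prod_XsubC. Qed.

Lemma orbit_poly_dvdp (O : {set 'I_n}) (p : {poly L}) :
  (forall i, i \in O -> root p (r i)) -> orbit_poly O %| p.
Proof.
move=> rootp; rewrite /orbit_poly -big_enum -(big_map r predT (fun x => 'X - x%:P)).
apply: uniq_roots_dvdp; last by rewrite uniq_rootsE map_inj_uniq ?enum_uniq.
by apply/allP => _ /mapP[i i_O ->]; rewrite rootp // -mem_enum.
Qed.

(** Frobenius permutes the linear factors of an orbit, so each coefficient c satisfies c^2 = c. *)
Lemma orbit_factorE O : O \in porbits s -> (orbit_factor O)^iota = orbit_poly O.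
Proof.
case/imsetP => i0 _ ->{O}; set O := porbit s i0.
have fixO : map_poly Frob (orbit_poly O) = orbit_poly O.
  rewrite rmorph_prod [RHS](reindex_inj (@perm_inj _ s)) /=.
  apply: eq_big => [i|i _]; last by rewrite rmorphB /= map_polyX map_polyC -Frob_r.
  by rewrite /O -!eq_porbit_mem -(porbit_perm s 1 i) expg1.
apply/polyP => k; rewrite coef_map coef_poly.
have [lt_k | le_k] := ltnP; last by rewrite raddf0 nth_default.
have /eqP: Frob (orbit_poly O)`_k = (orbit_poly O)`_k.
  by rewrite -[in RHS]fixO coef_map.
rewrite /Frob pFrobenius_autE -subr_eq0 expr2 -{3}[_`_k]mulr1 -mulrBr mulf_eq0 subr_eq0.
by case/orP => /eqP ->; rewrite ?eqxx ?oner_eq0; [apply: rmorph0 | apply: rmorph1].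
Qed.

Lemma monic_orbit_factor O : O \in porbits s -> orbit_factor O \is monic.
Proof. by move=> Os; rewrite -(map_monic iota) orbit_factorE ?monic_orbit_poly. Qed.

Lemma root_of_dvdp_orbit_poly (O : {set 'I_n}) (p : {poly L}) :
  p %| orbit_poly O -> size p != 1 -> exists2 i, i \in O & root p (r i).
Proof.
rewrite /orbit_poly -big_enum -(big_map r predT (fun x => 'X - x%:P)).
case/dvdp_prod_XsubC => m.
have: {subset mask m [seq r i | i <- enum O] <= [seq r i | i <- enum O]}.
  by move=> x; apply: mem_mask.
case: (mask m _) => [|x t] t_sub p_eq.
  by rewrite (eqp_size p_eq) big_nil size_poly1.
have /mapP[i] : x \in [seq r i | i <- enum O] by apply: t_sub; rewrite mem_head.
rewrite mem_enum => iO x_r _; exists i => //.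
by rewrite (eqp_root p_eq) big_cons rootM root_XsubC x_r eqxx.
Qed.

(** A nonconstant divisor has a root in the orbit, hence the whole orbit as roots. *)
Lemma irreducible_orbit_factor O :
  O \in porbits s -> irreducible_poly (orbit_factor O).
Proof.
move=> Os; have facE := orbit_factorE Os; split=> [|d sz_d d_dvd].
  rewrite -(size_map_poly iota) facE /orbit_poly -big_enum.
  rewrite -(big_map r predT (fun x => 'X - x%:P)) size_prod_XsubC size_map ltnS.
  case/imsetP: Os => i _ ->; rewrite -cardE card_gt0.
  by apply/set0Pn; exists i; rewrite porbit_id.
have [||i iO root_i] := @root_of_dvdp_orbit_poly O d^iota.
- by rewrite -facE dvdp_map.
- by rewrite size_map_poly.
rewrite /eqp d_dvd -(dvdp_map iota) facE; apply: orbit_poly_dvdp => j jO.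
apply: root_porbit root_i; case/imsetP: Os iO jO => k _ ->.
by rewrite -!eq_porbit_mem => /eqP -> .
Qed.

(** [orbit_factor] is a bijection from orbits to monic irreducible factors: the roots recover the
    orbit, and an irreducible factor with root r_i is the factor of the orbit of i. *)
Lemma nb_irreducible_factors_porbits (f : {poly 'F_2}) :
  f^iota = \prod_i ('X - (r i)%:P) ->
  nb_irreducible_factors f = #|porbits s|.
Proof.
move=> fE; have f_orbit : f^iota = orbit_poly setT.
  by rewrite fE; apply: eq_bigl => i; rewrite inE.
have f_neq0 : f != 0.
  by rewrite -(map_poly_eq0 iota) f_orbit monic_neq0 ?monic_orbit_poly.
have factor_dvd O : O \in porbits s -> orbit_factor O %| f.
  move=> Os; rewrite -(dvdp_map iota) orbit_factorE // f_orbit.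
  by apply: orbit_poly_dvdp => i _; rewrite root_orbit_poly inE.
pose N O := npolyp (size f) (orbit_factor O).
have NE O : O \in porbits s -> N O = orbit_factor O :> {poly 'F_2}.
  by move=> Os; apply: npolypK; apply: dvdp_leq (factor_dvd O Os).
rewrite -(card_in_imset (f := N)) => [|O1 O2 O1s O2s /(congr1 val) /= eqN]; last first.
  have: orbit_poly O1 = orbit_poly O2 by rewrite -!orbit_factorE // -!NE // eqN.
  by move=> eqO; apply/setP => i; rewrite -!root_orbit_poly eqO.
apply: eq_card => q; rewrite inE.
apply/and3P/imsetP => [[q_monic /irreducibleP q_irr q_dvd]|].
  have [||i _ root_i] := @root_of_dvdp_orbit_poly setT q^iota.
  - by rewrite -f_orbit dvdp_map.
  - by rewrite size_map_poly; case: q_irr => /gtn_eqF ->.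
  have Os : porbit s i \in porbits s by apply: imset_f.
  exists (porbit s i) => //; apply: val_inj; rewrite /= NE //.
  apply/eqP; rewrite eq_sym -eqp_monic ?monic_orbit_factor //.
  apply: q_irr.2; first by have [/gtn_eqF ->] := irreducible_orbit_factor Os.
  rewrite -(dvdp_map iota) orbit_factorE //; apply: orbit_poly_dvdp => j jO.
  exact: root_porbit root_i.
case=> O Os ->; rewrite NE // monic_orbit_factor // factor_dvd //.
by split=> //; apply/irreducibleP; apply: irreducible_orbit_factor.
Qed.

End FrobeniusOrbits.

(** * Discriminants and Newton's identities *)

Lemma deriv_prod_ord (R : comNzRingType) n (F : 'I_n -> {poly R}) :
  (\prod_i F i)^`() = \sum_i (F i)^`() * \prod_(j | j != i) F j.
Proof.
elim: n F => [|n IHn] F; first by rewrite !big_ord0 derivC.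
rewrite !big_ord_recl derivM IHn; congr (_ * _ + _).
  by rewrite [RHS]big_mkcond big_ord_recl /= mul1r.
rewrite mulr_sumr; apply: eq_bigr => i _.
rewrite mulrCA; congr (_ * _).
rewrite [RHS]big_mkcond big_ord_recl /= -big_mkcond; congr (_ * _).
Qed.

Lemma horner_deriv_prod_XsubC (R : comNzRingType) n (r : 'I_n -> R) i :
  (\prod_i ('X - (r i)%:P))^`().[r i] = \prod_(j | j != i) (r i - r j).
Proof.
rewrite deriv_prod_ord horner_sum (bigD1 i) //= [X in _ + X]big1 => [|k ne_ki].
  rewrite addr0 derivXsubC mul1r horner_prod.
  by apply: eq_bigr => j _; rewrite hornerXsubC.
rewrite derivXsubC mul1r (bigD1 i) 1?eq_sym //= hornerM hornerXsubC.
by rewrite subrr mul0r.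
Qed.

(** F'(r_i) is the product of the r_i - r_j over j != i, so each pair occurs twice, with opposite
    signs. *)
Lemma prod_deriv_roots (R : comNzRingType) n (r : 'I_n -> R) :
  \prod_i (\prod_i ('X - (r i)%:P))^`().[r i]
    = (-1) ^+ 'C(n, 2) * pairwise_diff r ^+ 2.
Proof.
have signE : \prod_(i < n) \prod_(j < n | (i < j)%N) (-1) = (-1) ^+ 'C(n, 2) :> R.
  rewrite (exchange_big_dep predT) //= -bin2_sum big_mkord -prodrXr.
  apply: eq_bigr => i _; rewrite /=.
  by rewrite -(big_ord_widen n (fun=> -1)) ?prodr_const ?card_ord // ltnW.
rewrite expr2 mulrA -signE {1}/pairwise_diff -big_split /=.
rewrite [X in _ * X]/pairwise_diff (exchange_big_dep predT) //= -big_split /=.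
apply: eq_bigr => i _; rewrite horner_deriv_prod_XsubC -big_split /=.
rewrite (bigID (fun j : 'I_n => (i < j)%N)) /=; congr (_ * _).
  apply: eq_big => [j|j _]; last by rewrite mulN1r opprB.
  by rewrite andbC; case: ltngtP => //; rewrite -val_eqE /=; lia.
by apply: eq_bigl => j; rewrite -val_eqE /=; lia.
Qed.

(** Both sides are the coefficient of X^(n-m-1) in P', which is the sum of the quotients P / (X -
    r_i). The term l = 0 equals n P_(n-m). *)
Lemma newton_identity (R : comNzRingType) n (r : 'I_n -> R) m : (m < n)%N ->
  let P := \prod_i ('X - (r i)%:P) in
  P`_(n - m) *+ (n - m) = \sum_(l < m.+1) P`_(n - m + l) * \sum_i r i ^+ l.
Proof.
move=> lt_mn P.
pose Q i := \prod_(j | j != i) ('X - (r j)%:P).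
have PE i : P = ('X - (r i)%:P) * Q i by rewrite /P (bigD1 i).
(* Synthetic division Q_k = P_(k+1) + r_i Q_(k+1), iterated d times; for k = n-m-1 and d = m+1 the
   remainder involves Q_n = 0. *)
have QE i k d : (Q i)`_k =
    \sum_(l < d) P`_(k.+1 + l) * r i ^+ l + r i ^+ d * (Q i)`_(k + d).
  elim: d => [|d IHd]; first by rewrite big_ord0 add0r mul1r addn0.
  rewrite big_ord_recr /= IHd -addrA; congr (_ + _).
  rewrite addSn (PE i) mulrBl coefB coefXM coefCM /= addnS exprSr; ring.
have Q_small i : (Q i)`_n = 0.
  have ->: Q i = \prod_(j in predC1 i) ('X - (r j)%:P) by [].
  rewrite nth_default // -big_enum -(big_map r predT (fun x => 'X - x%:P)).
  rewrite size_prod_XsubC size_map -cardE (cardC1 i) card_ord.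
  by case: (n) i => // -[].
have nmE : (n - m)%N = (n - m).-1.+1 by lia.
rewrite nmE -coef_deriv deriv_prod_ord coef_sum.
under eq_bigr => i _ do rewrite derivXsubC mul1r (QE i _ m.+1).
rewrite big_split /= [X in _ + X]big1 => [|i _]; last first.
  by rewrite (_ : (_ + m.+1)%N = n) ?Q_small ?mulr0 //; lia.
rewrite addr0 exchange_big; apply: eq_bigr => l _.
by rewrite mulr_sumr.
Qed.

(** The expansion of the product in powers of 2, where [e] is the second elementary symmetric
    function of the y_i. The factor c^2 avoids the exponents size - 1 and size - 2; the subring [A]
    records integrality. *)
Lemma prod_affine_mod8 (R : comNzRingType) (A : subringClosed R) (c : R)
    (I : Type) (s : seq I) (y : I -> R) :
  c \in A -> (forall i, y i \in A) ->
  exists e w, [/\ e \in A, w \in A,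
    (\sum_(i <- s) y i) ^+ 2 = \sum_(i <- s) y i ^+ 2 + e *+ 2
    & c ^+ 2 * \prod_(i <- s) (c + y i *+ 2) =
      c ^+ (size s).+2 + c ^+ (size s).+1 * (\sum_(i <- s) y i) *+ 2
        + (c ^+ size s * e) *+ 4 + w *+ 8].
Proof.
move=> cA yA; elim: s => [|i s [e [w [eA wA e_eq w_eq]]]].
  by exists 0, 0; rewrite !big_nil !rpred0; split=> //=; ring.
have sumA : \sum_(j <- s) y j \in A by apply: rpred_sum.
exists (e + y i * \sum_(j <- s) y j), (c * w + w * y i *+ 2 + c ^+ size s * e * y i).
rewrite !big_cons; split.
- by rewrite rpredD ?rpredM.
- by rewrite !(rpredD, rpredM, rpredMn, rpredX).
- by rewrite sqrrD e_eq; ring.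
rewrite mulrCA w_eq /= !exprS; ring.
Qed.

(** * The sparse polynomials *)

Definition sparse_poly (R : comNzRingType) n (S : {set 'I_n}) : {poly R} :=
  'X^n + \sum_(i in S) 'X^i + 1.

Lemma map_sparse_poly (R1 R2 : comNzRingType) (phi : {rmorphism R1 -> R2}) n
    (S : {set 'I_n}) :
  map_poly phi (sparse_poly R1 S) = sparse_poly R2 S.
Proof.
rewrite !rmorphD rmorph1 rmorph_sum /= map_polyXn.
by congr (_ + _ + _); apply: eq_bigr => i _; rewrite /= map_polyXn.
Qed.

Lemma coef_sparse_poly_eq0 (R : comNzRingType) n (S : {set 'I_n}) k :
  (0 < k < n)%N -> (forall i, i \in S -> i != k :> nat) ->
  (sparse_poly R S)`_k = 0.
Proof.
case/andP=> k_gt0 lt_kn notS.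
rewrite !coefD coefXn coef1 coef_sum ltn_eqF // gtn_eqF // big1 ?addr0 // => i iS.
by rewrite coefXn eq_sym (negPf (notS i iS)).
Qed.

Lemma size_sparse_poly_tail (R : comNzRingType) n (S : {set 'I_n}) :
  (0 < n)%N -> (size (\sum_(i in S) 'X^i + 1 : {poly R})%R < n.+1)%N.
Proof.
move=> n_gt0; rewrite ltnS (leq_trans (size_polyD _ _)) // geq_max size_poly1 n_gt0.
rewrite andbT (leq_trans (size_sum _ _ _)) //.
by apply/bigmax_leqP => i _; rewrite size_polyXn.
Qed.

Lemma size_sparse_poly (R : comNzRingType) n (S : {set 'I_n}) :
  (0 < n)%N -> size (sparse_poly R S) = n.+1.
Proof.
move=> n_gt0; rewrite /sparse_poly -addrA size_polyDl size_polyXn //.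
exact: size_sparse_poly_tail.
Qed.

Lemma monic_sparse_poly (R : comNzRingType) n (S : {set 'I_n}) :
  (0 < n)%N -> sparse_poly R S \is monic.
Proof.
move=> n_gt0; rewrite monicE /sparse_poly -addrA lead_coefDl ?lead_coefXn //.
by rewrite size_polyXn size_sparse_poly_tail.
Qed.

Lemma coef_sparse_poly_lead (R : comNzRingType) n (S : {set 'I_n}) :
  (0 < n)%N -> (sparse_poly R S)`_n = 1.
Proof.
move=> n_gt0; have := monic_sparse_poly R S n_gt0.
by rewrite monicE lead_coefE size_sparse_poly // => /eqP.
Qed.

(** The factor ['X] restores the exponents of the polynomial itself, so that the result can be
    compared with it. *)
Lemma mulX_deriv_sparse_poly (R : comNzRingType) n (S : {set 'I_n}) :
  'X * (sparse_poly R S)^`() = 'X^n *+ n + \sum_(i in S) 'X^i *+ i.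
Proof.
have mulX_deriv k : 'X * ('X^k)^`() = 'X^k *+ k :> {poly R}.
  by case: k => [|k]; rewrite derivXn ?mulr0 // mulrnAr -exprS.
rewrite !derivD derivC addr0 raddf_sum mulrDr mulX_deriv mulr_sumr.
by congr (_ + _); apply: eq_bigr => i _; rewrite mulX_deriv.
Qed.

Section Exponents.

Variables (n : nat) (S : {set 'I_n}).
Hypotheses (n_odd : odd n)
  (S_sub : S \subset [set i : 'I_n | [&& odd i, (0 < i)%N & (3 * i < n)%N]]
             :|: [set i : 'I_n | (i == n %[mod 4]) && (0 < i)%N]).

Let n_gt0 : (0 < n)%N. Proof. exact: odd_gt0. Qed.

Lemma exponentP i : i \in S ->
  [/\ odd i, (0 < i)%N & (3 * i < n)%N \/ i = n %[mod 4]].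
Proof.
move/(subsetP S_sub); rewrite !inE => /orP[/and3P[io i0 i3] | /andP[/eqP i4 i0]].
  by split=> //; left.
by split=> //; [lia | right].
Qed.

Lemma coef_sparse_poly_even (R : comNzRingType) k :
  (0 < k < n)%N -> ~~ odd k -> (sparse_poly R S)`_k = 0.
Proof.
move=> k_bd k_even; apply: coef_sparse_poly_eq0 => // i /exponentP[io _ _].
by apply: contraNneq k_even => <-.
Qed.

Lemma coef_sparse_poly_large (R : comNzRingType) k :
  (n <= 3 * k)%N -> (k < n)%N -> k <> n %[mod 4] -> (sparse_poly R S)`_k = 0.
Proof.
move=> k_ge k_lt k4; apply: coef_sparse_poly_eq0; first lia.
move=> i /exponentP[_ _ i_or]; apply/eqP => ik; rewrite ik in i_or.
by case: i_or => //; lia.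
Qed.

(** At a double root, x f' = f - 1 would read 0 = -1. *)
Lemma sparse_poly_separable_F2 (L : fieldType) (x : L) :
  2 \in [pchar L] -> ~~ (('X - x%:P) ^+ 2 %| sparse_poly L S).
Proof.
move=> char2; apply/negP => /dvdpP[q Fq].
have odd1 k : odd k -> k%:R = 1 :> {poly L}.
  move=> k_odd; rewrite -(odd_double_half k) k_odd -mul2n natrD natrM.
  by rewrite -[2%:R]polyC_natr (pcharf0 char2) polyC0 mul0r addr0.
have := mulX_deriv_sparse_poly L S.
have ->: 'X^n *+ n + \sum_(i in S) 'X^i *+ i = sparse_poly L S - 1.
  rewrite addrK -mulr_natr (odd1 n n_odd) mulr1; congr (_ + _).
  by apply: eq_bigr => i /exponentP[io _ _]; rewrite -mulr_natr (odd1 i io) mulr1.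
rewrite Fq derivM expr2 derivM derivXsubC => /(congr1 (fun p : {poly L} => p.[x])).
rewrite !(hornerM, hornerD, hornerN, hornerX, subrr, mulr0, mul0r, addr0, hornerC).
by rewrite add0r => /esym/eqP; rewrite oppr_eq0 oner_eq0.
Qed.

Section PowerSums.

Variables (R : comNzRingType) (r : 'I_n -> R).
Hypothesis FE : sparse_poly R S = \prod_i ('X - (r i)%:P).

(** In Newton's identity n - m is even. For l < m, even l meets a coefficient of even index, which
    is 0, and odd l a power sum that is 0 by induction. *)
Lemma power_sum_odd m : odd m -> (m < n)%N -> \sum_i r i ^+ m = 0.
Proof.
elim/ltn_ind: m => m IHm m_odd lt_mn.
have := newton_identity r lt_mn; rewrite /= -FE big_ord_recr /= big1 => [|l _].
  rewrite coef_sparse_poly_even ?mul0rn; [|lia|lia].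
  rewrite (subnK (ltnW lt_mn)) add0r => /esym.
  by rewrite coef_sparse_poly_lead // mul1r.
have [l_odd|l_even] := boolP (odd l).
  by rewrite IHm ?mulr0 // (ltn_trans _ lt_mn).
by rewrite coef_sparse_poly_even ?mul0r //; have := ltn_ord l; lia.
Qed.

(** In Newton's identity the left side and the term l = 0 combine to -m P_(n-m). The other terms
    with l < m vanish for odd l and are multiples of 4 by induction for even l. *)
Lemma power_sum_even m : ~~ odd m -> (0 < m)%N -> (3 * m < 2 * n)%N ->
  exists k : int, \sum_i r i ^+ m = k%:~R *+ 4.
Proof.
elim/ltn_ind: m => m IHm m_even m_gt0 m_lt; have lt_mn : (m < n)%N by lia.
have FintE k : (sparse_poly R S)`_k = ((sparse_poly int S)`_k)%:~R.
  by rewrite -(map_sparse_poly intr) coef_map.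
pose D (x : R) := exists k : int, x = k%:~R *+ 4.
have D0 : D 0 by exists 0; rewrite mul0rn.
have DD x y : D x -> D y -> D (x + y).
  by move=> [k ->] [l ->]; exists (k + l); rewrite rmorphD mulrnDl.
have DN x : D x -> D (- x).
  by move=> [k ->]; exists (- k); rewrite rmorphN mulNrn.
have DM (k : int) x : D x -> D (k%:~R * x).
  by move=> [l ->]; exists (k * l); rewrite rmorphM mulrnAr.
(* If 4 does not divide m, then n - m differs from n modulo 4 and exceeds n/3, so it is not an
   exponent. *)
have D4 : D ((sparse_poly R S)`_(n - m) *+ m).
  have [m4|m4] := altP (m %% 4 =P 0)%N.
    exists ((sparse_poly int S)`_(n - m) *+ (m %/ 4)).
    by rewrite FintE rmorphMn -mulrnA; congr (_ *+ _); lia.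
  by rewrite coef_sparse_poly_large ?mul0rn; [|lia|lia|move/eqP: m4; lia].
have := newton_identity r lt_mn; rewrite /= -FE big_ord_recr /= (subnK (ltnW lt_mn)).
rewrite coef_sparse_poly_lead // mul1r => newton.
have [d Dd sumE] : exists2 d, D d &
    \sum_(l < m) (sparse_poly R S)`_(n - m + l) * \sum_i r i ^+ l
      = (sparse_poly R S)`_(n - m) *+ n + d.
  case: m m_gt0 IHm m_even m_lt lt_mn {D4 newton} => // m _ IHm m_even m_lt lt_mn.
  rewrite big_ord_recl addn0 sumr_const card_ord mulr_natr.
  eexists; last reflexivity.
  apply: (big_ind D) => // l _.
  have [l_odd|l_even] := boolP (odd (lift ord0 l)).
    by rewrite power_sum_odd ?mulr0 //; have := ltn_ord (lift ord0 l); lia.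
  rewrite FintE; apply: DM; apply: IHm => //.
  by have := ltn_ord (lift ord0 l); lia.
have -> : \sum_i r i ^+ m = - ((sparse_poly R S)`_(n - m) *+ m) - d.
  apply: (addrI ((sparse_poly R S)`_(n - m) *+ n + d)).
  rewrite -sumE -newton sumE.
  have ->: (sparse_poly R S)`_(n - m) *+ n
      = (sparse_poly R S)`_(n - m) *+ (n - m) + (sparse_poly R S)`_(n - m) *+ m.
    by rewrite -mulrnDr subnK // ltnW.
  by rewrite addrACA addrA addrK addrK.
by apply: DD; apply: DN.
Qed.

End PowerSums.
End Exponents.

(** * The discriminant modulo 8 *)

Section Discriminant.

Variables (n : nat) (S : {set 'I_n}).
Hypotheses (n_odd : odd n)
  (S_sub : S \subset [set i : 'I_n | [&& odd i, (0 < i)%N & (3 * i < n)%N]]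
             :|: [set i : 'I_n | (i == n %[mod 4]) && (0 < i)%N]).
Variable r : 'I_n -> algC.
Hypothesis FE : sparse_poly algC S = \prod_i ('X - (r i)%:P).

Let n_gt0 : (0 < n)%N. Proof. exact: odd_gt0. Qed.

Let root_r i : root (sparse_poly algC S) (r i).
Proof. by rewrite FE /root horner_prod (bigD1 i) //= hornerXsubC subrr mul0r. Qed.

Let Aint_r i : r i \in Aint.
Proof.
apply: root_monic_Aint (root_r i) _ _; first exact: monic_sparse_poly.
apply/polyOverP => k; rewrite -(map_sparse_poly intr) coef_map.
exact: Num.Theory.intr_int.
Qed.

(** Eliminating r_i^n by F(r_i) = 0 gives r_i F'(r_i) = -n - sum_j (n - j) r_i^j. Each n - j is
    even, so the halves are exact. *)
Let weighted i : algC := \sum_(j in S) r i ^+ j *+ (n - j)./2.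

Let mul_root_deriv i :
  r i * (sparse_poly algC S)^`().[r i] = - (n%:R + weighted i *+ 2).
Proof.
have := congr1 (horner^~ (r i)) (mulX_deriv_sparse_poly algC S).
rewrite hornerM hornerX => ->.
have := rootP (root_r i).
rewrite !hornerD hornerC !horner_sum hornerMn !hornerXn => /eqP.
rewrite -addrA addr_eq0 => /eqP ->.
have ->: \sum_(j in S) ('X^j *+ j).[r i] = \sum_(j in S) r i ^+ j *+ j.
  by apply: eq_bigr => j _; rewrite hornerMn hornerXn.
have splitE : (\sum_(j in S) 'X^j.[r i]) *+ n
    = \sum_(j in S) r i ^+ j *+ j + weighted i *+ 2.
  rewrite -!sumrMnl -big_split; apply: eq_bigr => j jS /=.
  rewrite hornerXn -mulrnA -mulrnDr; congr (_ *+ _).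
  by have [j_odd _ _] := exponentP n_odd S_sub jS; have := ltn_ord j; lia.
have cancel_l (a b c : algC) : - (a + b + c) + a = - (c + b) by ring.
by rewrite mulNrn mulrnDl splitE cancel_l.
Qed.

Let prod_roots : \prod_i r i = -1.
Proof.
have : (sparse_poly algC S).[0] = \prod_i (- r i).
  by rewrite FE horner_prod; apply: eq_bigr => i _; rewrite hornerXsubC sub0r.
rewrite prodrN cardT size_enum_ord -signr_odd n_odd expr1 mulN1r => /(canLR opprK) <-.
rewrite !hornerD hornerC hornerXn expr0n gtn_eqF // horner_sum big1 ?add0r //.
by move=> j /(exponentP n_odd S_sub)[_ j_gt0 _]; rewrite hornerXn expr0n gtn_eqF.
Qed.

(** The product -1 of the roots cancels the n minus signs of [mul_root_deriv], n being odd. *)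
Let prod_deriv :
  \prod_i (sparse_poly algC S)^`().[r i] = \prod_i (n%:R + weighted i *+ 2).
Proof.
apply: oppr_inj; rewrite -mulN1r -prod_roots -big_split /=.
rewrite (eq_bigr _ (fun i _ => mul_root_deriv i)) prodrN.
by rewrite cardT size_enum_ord -signr_odd n_odd expr1 mulN1r.
Qed.

Let sum_weighted : \sum_i weighted i = 0.
Proof.
rewrite exchange_big big1 // => j /(exponentP n_odd S_sub)[j_odd _ _].
by rewrite sumrMnl (power_sum_odd n_odd S_sub FE) ?mul0rn.
Qed.

(** Exponents j >= n/3 are congruent to n modulo 4, so their part of y_i is 2 v_i, and y_i^2 = u_i^2
    + 4 (u_i v_i + v_i^2). The squares u_i^2 only involve even powers j + k < 2n/3. *)
Let sum_weighted_sqr : exists2 w, w \in Aint & \sum_i weighted i ^+ 2 = w *+ 4.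
Proof.
pose u i : algC := \sum_(j in S | (3 * j < n)%N) r i ^+ j *+ (n - j)./2.
pose v i : algC := \sum_(j in S | ~~ (3 * j < n)%N) r i ^+ j *+ (n - j)./2./2.
have uA i : u i \in Aint by rewrite rpred_sum // => j _; rewrite rpredMn ?rpredX.
have vA i : v i \in Aint by rewrite rpred_sum // => j _; rewrite rpredMn ?rpredX.
have wE i : weighted i = u i + v i *+ 2.
  rewrite /weighted (bigID (fun j : 'I_n => (3 * j < n)%N)) /=; congr (_ + _).
  rewrite -sumrMnl; apply: eq_bigr => j /andP[jS j_large].
  rewrite -mulrnA; congr (_ *+ _).
  by have [_ _] := exponentP n_odd S_sub jS; lia.
have [w wA wE2] : exists2 w, w \in Aint & \sum_i u i ^+ 2 = w *+ 4.
  pose D (x : algC) := exists2 w, w \in Aint & x = w *+ 4.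
  have D_sum (P : pred 'I_n) F : (forall j, P j -> D (F j)) -> D (\sum_(j | P j) F j).
    move=> DF; apply: (big_ind D) => //; first by exists 0; rewrite ?mul0rn.
    by move=> x y [w wA ->] [w' w'A ->]; exists (w + w'); rewrite ?rpredD ?mulrnDl.
  under eq_bigr do rewrite expr2 big_distrl /=.
  rewrite exchange_big; apply: (D_sum) => j /andP[jS j_small].
  under eq_bigr do rewrite big_distrr /=.
  rewrite exchange_big; apply: D_sum => k /andP[kS k_small].
  under eq_bigr do rewrite mulrnAl mulrnAr -exprD -mulrnA.
  have [j_odd j_gt0 _] := exponentP n_odd S_sub jS.
  have [k_odd _ _] := exponentP n_odd S_sub kS.
  have [|||z zE] := power_sum_even n_odd S_sub FE (m := (j + k)%N).
  - by rewrite oddD j_odd k_odd.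
  - by rewrite addn_gt0 j_gt0.
  - lia.
  rewrite sumrMnl zE -mulrnA mulnC mulrnA.
  by eexists; last reflexivity; rewrite rpredMn ?Aint_int.
exists (w + \sum_i (u i * v i + v i ^+ 2)).
  by rewrite rpredD // rpred_sum // => i _; rewrite rpredD ?rpredM ?rpredX.
rewrite mulrnDl -wE2 -sumrMnl -big_split; apply: eq_bigr => i _.
by rewrite /= wE; ring.
Qed.

Lemma discriminant_mod8 : exists2 w, w \in Aint &
  n%:R ^+ 2 * ((-1) ^+ 'C(n, 2) * pairwise_diff r ^+ 2) = n%:R ^+ n.+2 + w *+ 8.
Proof.
rewrite -prod_deriv_roots -FE prod_deriv.
have weightedA i : weighted i \in Aint.
  by rewrite rpred_sum // => j _; rewrite rpredMn ?rpredX.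
have nA : n%:R \in Aint by apply: rpred_nat.
have [e [w [eA wA e_eq ->]]] :=
  prod_affine_mod8 (index_enum 'I_n) nA weightedA.
have size_n : size (index_enum 'I_n) = n.
  by rewrite /index_enum unlock -enumT size_enum_ord.
have [w' w'A w'E] := sum_weighted_sqr.
move: e_eq; rewrite sum_weighted w'E expr0n size_n => /esym/eqP.
rewrite addrC addr_eq0 => /eqP e_eq.
exists (w - n%:R ^+ n * w'); first by rewrite rpredB ?rpredM ?rpredX.
(* From 0 = 4 w' + 2 e one gets 2 e = -4 w', so the term in 4 e is a multiple of 8. *)
rewrite (_ : n%:R ^+ n * e *+ 4 = n%:R ^+ n * (e *+ 2) *+ 2); last by ring.
by rewrite e_eq; ring.
Qed.

End Discriminant.

(** * Parity of the number of factors *)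

Lemma closed_field_monic_split (L : closedFieldType) n (p : {poly L}) :
  p \is monic -> size p = n.+1 ->
  exists r : 'I_n -> L, p = \prod_i ('X - (r i)%:P).
Proof.
move=> /monicP p_lead sz_p; have [s pE] := closed_field_poly_normal p.
rewrite p_lead scale1r in pE; rewrite pE size_prod_XsubC in sz_p.
case: sz_p => sz_s; exists (fun i => s`_i).
by rewrite pE (big_nth 0) sz_s big_mkord.
Qed.

Lemma intr_pchar2 (R : nzRingType) (z : int) :
  2 \in [pchar R] -> z%:~R = (odd `|z|)%:R :> R.
Proof.
move=> char2; have natE k : k%:R = (odd k)%:R :> R.
  by rewrite -{1}(odd_double_half k) -mul2n natrD natrM (pcharf0 char2) mul0r addr0.
by case: z => k; rewrite ?NegzE ?rmorphN /= ?(oppr_pchar2 char2); apply: natE.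
Qed.

Lemma odd_sqr_mod8 (a : int) : odd `|a| -> exists t : int, a ^+ 2 = 1 + t *+ 8.
Proof.
move=> a_odd.
have [b ->] : exists b : int, a = b *+ 2 + 1.
  exists ((a - 1) %/ 2)%Z; lia.
have [c cE] : exists c : int, b * (b + 1) = c *+ 2.
  have [d [->|->]] : exists d : int, b = d *+ 2 \/ b = d *+ 2 + 1.
  - by exists (b %/ 2)%Z; lia.
  - by exists (d * (d *+ 2 + 1)); ring.
  - by exists ((d *+ 2 + 1) * (d + 1)); ring.
exists c; rewrite (_ : 8 = 2 * 4)%N // mulrnA -cE; ring.
Qed.

(** As n^2 and a^2 are 1 modulo 8, the equation reduces to (-1)^((n-1)/2) (1 - 4 q) = n modulo 8,
    which settles the parity of q in each class of n. *)
Lemma odd_quarter_discriminant_mod8 n (a q k : int) : odd n -> odd `|a| ->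
  n%:Z ^+ 2 * ((-1) ^+ 'C(n, 2) * (a ^+ 2 - q *+ 4)) = n%:Z ^+ n.+2 + k *+ 8 ->
  odd `|q| = (n %% 8 == 3)%N || (n %% 8 == 5)%N.
Proof.
move=> n_odd a_odd.
have [t tE] := @odd_sqr_mod8 n n_odd.
have [u ->] := odd_sqr_mod8 a_odd.
have [v ->] : exists v : int, n%:Z ^+ n.+2 = n%:Z + v *+ 8.
  have -> : n.+2 = (1 + 2 * (n./2).+1)%N by lia.
  rewrite exprD expr1 exprM tE.
  elim: (n./2.+1) => [|m [v vE]]; first by exists 0; rewrite expr0 mulr1 mul0rn addr0.
  by exists (v * (1 + t *+ 8) + n%:Z * t); rewrite exprS mulrCA vE; ring.
rewrite tE bin2odd // -signr_odd oddM n_odd /=.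
set X := 1 + u *+ 8 - q *+ 4; set sg := (-1) ^+ _ => e.
have [w wE] : exists w : int, sg * (1 - q *+ 4) = n%:Z + w *+ 8.
  exists (v + k - t * (sg * X) - sg * u).
  have -> : n%:Z = (1 + t *+ 8) * (sg * X) - v *+ 8 - k *+ 8 by rewrite e; ring.
  by rewrite /X; ring.
move: wE; rewrite {e}/sg.
by case: (boolP (odd n.-1./2)) => h_odd; rewrite ?expr1 ?expr0 ?mul1r ?mulN1r; lia.
Qed.

Theorem mainTheorem1 (n : nat) (S : {set 'I_n}) :
  odd n ->
  S \subset [set i : 'I_n | [&& odd i, (0 < i)%N & (3 * i < n)%N]]
            :|: [set i : 'I_n | (i == n %[mod 4]) && (0 < i)%N] ->
  let f : {poly 'F_2} := 'X^n + \sum_(i in S) 'X^i + 1 in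
  [/\ no_repeated_roots f,
      (n = 1 %[mod 8] \/ n = 7 %[mod 8] -> odd (nb_irreducible_factors f))
    & (n = 3 %[mod 8] \/ n = 5 %[mod 8] -> ~~ odd (nb_irreducible_factors f))].
Proof.
move=> n_odd S_sub f; have n_gt0 := odd_gt0 n_odd.
have separable (L : fieldType) (iota : {rmorphism 'F_2 -> L}) x :
    ~~ (('X - x%:P) ^+ 2 %| map_poly iota f).
  rewrite (map_sparse_poly iota S).
  by apply: sparse_poly_separable_F2 => //; apply: pchar_F2_ext iota.
have [K [iota _]] := countable_algebraic_closure 'F_2.
pose L : closedFieldType := K.
have char2 : 2 \in [pchar L] := pchar_F2_ext iota.
have [rb fE] := closed_field_monic_split
  (monic_sparse_poly L S n_gt0) (size_sparse_poly L S n_gt0).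
have injrb : injective rb.
  move=> i j rb_ij; apply: contraTeq (separable L iota (rb i)) => ne_ij.
  rewrite negbK (map_sparse_poly iota S) fE (bigD1 i) //= (bigD1 j) 1?eq_sym //=.
  by rewrite mulrA -rb_ij -expr2 dvdp_mulIl.
(* Frobenius maps roots of f to roots of f and is injective. *)
have [s frob] : exists s : 'S_n, forall i, rb (s i) = rb i ^+ 2.
  have /fin_all_exists[t tE] (i : 'I_n) : exists j, rb j = rb i ^+ 2.
    have : root (sparse_poly L S) (rb i ^+ 2).
      rewrite -(map_sparse_poly (pFrobenius_aut char2)) -(pFrobenius_autE char2).
      by rewrite rmorph_root // fE /root horner_prod (bigD1 i) //=
        hornerXsubC subrr mul0r.
    rewrite fE /root horner_prod => /prodf_eq0[j _].
    by rewrite hornerXsubC subr_eq0 => /eqP; exists j.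
  have injt : injective t.
    move=> i j eq_t; apply: injrb; apply: (fmorph_inj (pFrobenius_aut char2)).
    by rewrite /= !pFrobenius_autE -!tE eq_t.
  by exists (perm injt) => i; rewrite permE.
have nbE : nb_irreducible_factors f = #|porbits s|.
  apply: (nb_irreducible_factors_porbits injrb frob (iota := iota)).
  by rewrite (map_sparse_poly iota S).
have [r FE] := closed_field_monic_split
  (monic_sparse_poly algC S n_gt0) (size_sparse_poly algC S n_gt0).
have [a [q [char0_inv char2_inv]]] := swan_invariants n (sparse_poly int S).
have [_ dE] := char0_inv _ r (etrans (map_sparse_poly _ S) FE).
have [A1 qE] := char2_inv _ rb s (etrans (map_sparse_poly _ S) fE) char2 injrb frob.
have [aE _] := char0_inv _ rb (etrans (map_sparse_poly _ S) fE).
have a_odd : odd `|a|.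
  move: A1; rewrite aE (intr_pchar2 _ char2).
  by case: odd => // /esym/eqP; rewrite oner_eq0.
have q_odd : odd `|q| = s.
  move: qE; rewrite (intr_pchar2 _ char2).
  by case: odd (odd_perm s) => [] [] // /eqP; rewrite ?oner_eq0 // eq_sym oner_eq0.
have [k kE] : exists k : int,
  n%:Z ^+ 2 * ((-1) ^+ 'C(n, 2) * (a ^+ 2 - q *+ 4)) = n%:Z ^+ n.+2 + k *+ 8.
  have [w wA wE] := discriminant_mod8 n_odd S_sub FE.
  (* So far w is only an algebraic integer; being z/8 it is also rational, hence an integer. *)
  pose z := n%:Z ^+ 2 * ((-1) ^+ 'C(n, 2) * (a ^+ 2 - q *+ 4)) - n%:Z ^+ n.+2.
  have zE : z%:~R = w *+ 8.
    rewrite /z rmorphB rmorphM rmorphXn rmorphM rmorph_sign [X in X - _]/= -dE.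
    by rewrite rmorphXn /= -pmulrn wE addrAC subrr add0r.
  have : w \in Num.int.
    apply: Cint_rat_Aint => //; apply/CratP; exists (z%:~R / 8%:R).
    by rewrite fmorph_div rmorph_int rmorph_nat zE -[w *+ 8]mulr_natr mulfK //
      Num.Theory.pnatr_eq0.
  case/Num.Theory.intrP => k kE; exists k.
  suff -> : k *+ 8 = z by rewrite /z addrCA subrr addr0.
  by apply: (@intr_inj algC); rewrite zE kE rmorphMn.
have := odd_quarter_discriminant_mod8 n_odd a_odd kE.
(* The sign of [s] is the parity of n minus the number of orbits; with n odd, the number of factors
   is odd exactly when q is even. *)
rewrite q_odd /odd_perm card_ord n_odd -nbE addTb => nb_parity.
split=> [L' iota' _ x||]; first exact: separable.
- move=> n8; lia.
- move=> n8; lia.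
Qed.
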